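(* Consider the one-bit sparse-linear-array model described in the context. For $\boldsymbol{\theta}_0 \in [-\pi/2,\pi/2]^{K}$, the source DoAs are identifiable from the one-bit data $\mathbf{X}$ at $\boldsymbol{\theta}_0$ if and only if they are identifiable from the unquantized data $\mathbf{Y}$ at $\boldsymbol{\theta}_0$.
   Context: Sparse linear array (SLA): $\mathbb{M}=\{m_1,\dots,m_M\}$ is a set of $M$ distinct integers (sensor positions $m_i\lambda/2$). For $\theta\in[-\pi/2,\pi/2]$ let $\mathbf{a}(\theta)=[e^{j\pi\sin\theta\, m_1},\dots,e^{j\pi\sin\theta\, m_M}]^T$, and for $\boldsymbol{\theta}=(\theta_1,\dots,\theta_K)^T$ (with distinct entries) let $\mathbf{A}(\boldsymbol{\theta})=[\mathbf{a}(\theta_1),\dots,\mathbf{a}(\theta_K)]\in\mathbb{C}^{M\times K}$. Measurements: $\mathbf{y}(t)=\mathbf{A}(\boldsymbol{\theta})\mathbf{s}(t)+\mathbf{n}(t)$, $t=0,\dots,N-1$, where $\mathbf{n}(t)\sim\mathcal{CN}(\mathbf{0},\sigma^2\mathbf{I}_M)$, $\mathbf{s}(t)\sim\mathcal{CN}(\mathbf{0},\mathrm{diag}(\mathbf{p}))$ with $\mathbf{p}\in\mathbb{R}_{>0}^{K}$ (uncorrelated circular complex Gaussian sources), sources and noise mutually independent, and no temporal correlation between snapshots (all $\mathbf{s}(t),\mathbf{n}(t)$ independent across $t$). One-bit data: $[\mathbf{x}(t)]_m=\frac{1}{\sqrt2}\mathrm{sgn}(\Re\{[\mathbf{y}(t)]_m\})+\frac{j}{\sqrt2}\mathrm{sgn}(\Im\{[\mathbf{y}(t)]_m\})$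 with $\mathrm{sgn}(x)=1$ for $x\ge0$ and $-1$ otherwise. $\mathbf{Y}=[\mathbf{y}(0),\dots,\mathbf{y}(N-1)]$, $\mathbf{X}=[\mathbf{x}(0),\dots,\mathbf{x}(N-1)]$. Let $f(\mathbf{X}\mid\boldsymbol{\theta},\mathbf{p},\sigma^2)$ (resp. $f(\mathbf{Y}\mid\boldsymbol{\theta},\mathbf{p},\sigma^2)$) denote the probability distribution of $\mathbf{X}$ (resp. $\mathbf{Y}$) under parameters $(\boldsymbol{\theta},\mathbf{p},\sigma^2)$. Identifiability: the DoAs are identifiable from $\mathbf{X}$ at $\boldsymbol{\theta}_0$ if there exist no $\breve{\boldsymbol{\theta}}\neq\boldsymbol{\theta}_0$ in $[-\pi/2,\pi/2]^K$, $\mathbf{p},\breve{\mathbf{p}}\in\mathbb{R}_{>0}^K$ and noise variances $\sigma^2,\breve{\sigma}^2$ such that $f(\mathbf{X}\mid\boldsymbol{\theta}_0,\mathbf{p},\sigma^2)=f(\mathbf{X}\mid\breve{\boldsymbol{\theta}},\breve{\mathbf{p}},\breve{\sigma}^2)$; identifiability from $\mathbf{Y}$ is defined identically with $\mathbf{Y}$ in place of $\mathbf{X}$. *)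

(* Defs.v *)
From HB Require Import structures.
From mathcomp Require Import all_boot all_order all_algebra.
From mathcomp Require Import all_classical all_reals all_analysis.
From mathcomp.real_closed Require Import complex.
Set Implicit Arguments. Unset Strict Implicit. Unset Printing Implicit Defensive.
Import Order.TTheory GRing.Theory Num.Theory.
Local Open Scope classical_set_scope.
Local Open Scope ring_scope.

Section SLA.
Context {R : realType}.

Definition steer (m : int) (th : R) : R[i] :=
  Complex (cos (pi * sin th * m%:~R)) (sin (pi * sin th * m%:~R)).

Definition steer_mx (M K : nat) (pos : 'I_M -> int) (th : 'I_K -> R)
  : 'M[R[i]]_(M, K) := \matrix_(m, k) steer (pos m) (th k).

Definition sgnr (x : R) : R := if 0 <= x then 1 else -1.

Definition quant (y : R[i]) : R[i] :=
  Complex (sgnr (complex.Re y) / Num.sqrt 2) (sgnr (complex.Im y) / Num.sqrt 2).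

Definition mutually_independent d (T : measurableType d)
    (P : probability T R) (I : finType) (Z : I -> T -> R) : Prop :=
  (forall i, measurable_fun setT (Z i)) /\
  forall B : I -> set R, (forall i, measurable (B i)) ->
    fine (P (\bigcap_(i in [set: I]) (Z i @^-1` B i))) =
    \prod_(i : I) fine (P (Z i @^-1` B i)).

(* Z ~ N(0, s^2)  (s = standard deviation) *)
Definition gauss_law d (T : measurableType d) (P : probability T R)
    (Z : T -> R) (s : R) : Prop :=
  forall B : set R, measurable B -> P (Z @^-1` B) = normal_prob 0 s B.

(* index of the latent real Gaussian variables:
   inl (k, t, b) : Re (b = false) / Im (b = true) of s_k(t);
   inr (m, t, b) : Re / Im of n_m(t). *)
Definition latent (K M N : nat) : finType :=
  (('I_K * 'I_N * bool) + ('I_M * 'I_N * bool))%type.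

(* A realization on (T, P) of the model with powers p and noise variance s2:
   all real and imaginary parts of all s_k(t), n_m(t) mutually independent,
   Re/Im of s_k(t) ~ N(0, p_k/2), Re/Im of n_m(t) ~ N(0, s2/2)
   (i.e. s(t) ~ CN(0, diag p), n(t) ~ CN(0, s2 I), all independent). *)
Definition realization (K M N : nat) (p : 'I_K -> R) (s2 : R)
    d (T : measurableType d) (P : probability T R)
    (W : latent K M N -> T -> R) : Prop :=
  [/\ mutually_independent P W,
      (forall k t b, gauss_law P (W (inl (k, t, b))) (Num.sqrt (p k / 2))) &
      (forall m t b, gauss_law P (W (inr (m, t, b))) (Num.sqrt (s2 / 2)))].

Definition src (K M N : nat) T (W : latent K M N -> T -> R) (w : T)
  : 'M[R[i]]_(K, N) :=
  \matrix_(k, t) Complex (W (inl (k, t, false)) w) (W (inl (k, t, true)) w).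

Definition noise (K M N : nat) T (W : latent K M N -> T -> R) (w : T)
  : 'M[R[i]]_(M, N) :=
  \matrix_(m, t) Complex (W (inr (m, t, false)) w) (W (inr (m, t, true)) w).

Definition dataY (K M N : nat) (pos : 'I_M -> int) (th : 'I_K -> R) T
    (W : latent K M N -> T -> R) (w : T) : 'M[R[i]]_(M, N) :=
  steer_mx pos th *m src W w + noise W w.

Definition dataX (K M N : nat) (pos : 'I_M -> int) (th : 'I_K -> R) T
    (W : latent K M N -> T -> R) (w : T) : 'M[R[i]]_(M, N) :=
  map_mx quant (dataY pos th W w).

Definition realvec (M N : nat) (Y : 'M[R[i]]_(M, N))
  : #|{: 'I_M * 'I_N * bool}|.-tuple R :=
  fgraph [ffun i : 'I_M * 'I_N * bool =>
            let: (m, t, b) := i in if b then complex.Im (Y m t) else complex.Re (Y m t)].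

Definition same_law_Y (K M N : nat) (pos : 'I_M -> int)
    (th1 th2 : 'I_K -> R)
    d1 (T1 : measurableType d1) (P1 : probability T1 R) (W1 : latent K M N -> T1 -> R)
    d2 (T2 : measurableType d2) (P2 : probability T2 R) (W2 : latent K M N -> T2 -> R)
  : Prop :=
  forall B : set (#|{: 'I_M * 'I_N * bool}|.-tuple R), measurable B ->
    P1 ((fun w => realvec (dataY pos th1 W1 w)) @^-1` B) =
    P2 ((fun w => realvec (dataY pos th2 W2 w)) @^-1` B).

Definition same_law_X (K M N : nat) (pos : 'I_M -> int)
    (th1 th2 : 'I_K -> R)
    d1 (T1 : measurableType d1) (P1 : probability T1 R) (W1 : latent K M N -> T1 -> R)
    d2 (T2 : measurableType d2) (P2 : probability T2 R) (W2 : latent K M N -> T2 -> R)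
  : Prop :=
  forall x : 'M[R[i]]_(M, N),
    P1 [set w | dataX pos th1 W1 w = x] = P2 [set w | dataX pos th2 W2 w = x].

Definition doa_range (K : nat) (th : 'I_K -> R) : Prop :=
  forall k, - (pi / 2) <= th k <= pi / 2.

Definition identifiable_Y (K M : nat) (N : nat) (pos : 'I_M -> int)
    (th0 : 'I_K -> R) : Prop :=
  ~ exists (thb : 'I_K -> R) (p pb : 'I_K -> R) (s2 s2b : R),
      [/\ thb <> th0, injective thb & doa_range thb] /\
      [/\ (forall k, 0 < p k), (forall k, 0 < pb k), 0 < s2 & 0 < s2b] /\
      exists d1 (T1 : measurableType d1) (P1 : probability T1 R)
             (W1 : latent K M N -> T1 -> R)
             d2 (T2 : measurableType d2) (P2 : probability T2 R)
             (W2 : latent K M N -> T2 -> R),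
        [/\ realization p s2 P1 W1, realization pb s2b P2 W2 &
            same_law_Y pos th0 thb P1 W1 P2 W2].

Definition identifiable_X (K M : nat) (N : nat) (pos : 'I_M -> int)
    (th0 : 'I_K -> R) : Prop :=
  ~ exists (thb : 'I_K -> R) (p pb : 'I_K -> R) (s2 s2b : R),
      [/\ thb <> th0, injective thb & doa_range thb] /\
      [/\ (forall k, 0 < p k), (forall k, 0 < pb k), 0 < s2 & 0 < s2b] /\
      exists d1 (T1 : measurableType d1) (P1 : probability T1 R)
             (W1 : latent K M N -> T1 -> R)
             d2 (T2 : measurableType d2) (P2 : probability T2 R)
             (W2 : latent K M N -> T2 -> R),
        [/\ realization p s2 P1 W1, realization pb s2b P2 W2 &
            same_law_X pos th0 thb P1 W1 P2 W2].

End SLA.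

(* Main.v *)
Require Import Defs.
From HB Require Import structures.
From mathcomp Require Import all_boot all_order all_algebra.
From mathcomp Require Import all_classical all_reals all_analysis.
From mathcomp.real_closed Require Import complex.
From mathcomp Require Import measurable_realfun ring lra.
Set Implicit Arguments. Unset Strict Implicit. Unset Printing Implicit Defensive.
Import Order.TTheory GRing.Theory Num.Theory.
Import numFieldNormedType.Exports.
Local Open Scope classical_set_scope.
Local Open Scope ring_scope.

(** Both data sets are functions of real coordinates y_j = <a_j, z>, where z is
    a vector of independent standard normal variables and j ranges over sensors,
    snapshots and real/imaginary parts; all a_j have the same squared norm
    r = (sum of the powers + noise variance) / 2, because steering vectors have
    unit-modulus entries.  The probability that y_j >= 0 and y_k >= 0 is strictly
    increasing in <a_j, a_k> / r, so the law of X determines the Gram matrix of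
    the a_j up to a positive factor.  That factor is absorbed by rescaling the
    alternative powers and noise variance.  Two families of vectors with equal
    Gram matrices are exchanged by a product of Householder reflections, under
    which the law of z is invariant; transporting z by this product yields a
    realization of the alternative parameters on the same probability space with
    the very same Y. *)

(** * Change of variables under increasing affine maps of the line *)

Section affine_substitution.
Context {R : realType}.
Local Notation mu := (@lebesgue_measure R).
Variables (a b : R).
Hypothesis a0 : 0 < a.

Let affine (x : measurableTypeR R) : measurableTypeR R := a * x + b.

Let measurable_affine : measurable_fun [set: measurableTypeR R] affine.
Proof. by apply: measurable_funD => //; apply: measurable_funM. Qed.

Let affine_image : {measure set (measurableTypeR R) -> \bar R}.
Proof. refine (pushforward mu affine); exact: measurable_affine. Defined.

Let scaled_image : {measure set (measurableTypeR R) -> \bar R} :=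
  mscale (NngNum (ltW a0)) affine_image.

(** Lebesgue measure is determined by its values on half-open intervals. The preimage of []l, r]]
    under [affine] has length [(r - l) / a], and the factor [a] in [scaled_image] compensates for
    this. *)
Let scaled_imageE A : measurable A -> mu A = scaled_image A.
Proof.
apply: lebesgue_measure_unique => _ [[l r]] _ <-.
rewrite /scaled_image /= /mscale /= /pushforward.
have -> : affine @^-1` `]l, r] = `](l - b) / a, (r - b) / a]%classic.
  apply/seteqP; split=> x /=; rewrite !in_itv /= ltr_pdivrMr// ler_pdivlMr//;
    by rewrite ltrBlDr lerBrDr (mulrC x).
rewrite !lebesgue_measure_itv /= !lte_fin ltr_pM2r ?invr_gt0// ltrD2r.
case: ifP => _; last by rewrite mule0.
by rewrite -!EFinB -EFinM; congr EFin; field; rewrite gt_eqF.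
Qed.

Lemma ge0_integral_affine (f : R -> \bar R) : measurable_fun setT f ->
  (forall x, (0 <= f x)%E) ->
  (\int[mu]_x f x = a%:E * \int[mu]_x f (a * x + b)%R)%E.
Proof.
move=> mf f0.
rewrite (@eq_measure_integral _ _ _ _ scaled_image); last first.
  by move=> A mA _; exact: scaled_imageE.
rewrite ge0_integral_mscale //=.
by rewrite (ge0_integral_pushforward measurable_affine)// preimage_setT.
Qed.

End affine_substitution.

(** * Scaling, reflection and plane rotation of standard normal laws *)

Section standard_gaussian.
Context {R : realType}.
Local Notation mu := (@lebesgue_measure R).
Local Notation phi := (normal_pdf (0 : R) 1).
Local Notation gauss := (normal_prob (0 : R) 1).

Lemma normal_prob_indicE (s : R) (A : set R) : measurable A ->
  normal_prob 0 s A = (\int[mu]_x (\1_A x * normal_pdf 0 s x)%:E)%E.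
Proof.
move=> mA; rewrite /normal_prob integral_mkcond /=.
apply: eq_integral => x _; rewrite patchE indicE.
by case: ifP; rewrite ?mul1r ?mul0r.
Qed.

Lemma measurable_indic_normal_pdf (s : R) (A : set R) : measurable A ->
  measurable_fun setT (fun x : R => (\1_A x * normal_pdf 0 s x)%:E).
Proof.
move=> mA; apply/measurable_EFinP; apply: measurable_funM => //.
exact: measurable_normal_pdf.
Qed.

Lemma std_normal_pdfE x : phi x = normal_peak 1 * expR (- (x ^+ 2 / 2)).
Proof.
rewrite normal_pdfE ?oner_eq0// /normal_fun subr0 expr1n mulNr.
by rewrite -[1 *+ 2]/(2%:R).
Qed.

(** The substitution by [s * x] produces a factor [s], which cancels the [1 / s] contained in the
    peak of the density of deviation [s]. *)
Lemma normal_prob_scale (s : R) (A : set R) : 0 < s -> measurable A ->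
  normal_prob 0 s A = gauss ((fun x => s * x) @^-1` A).
Proof.
move=> s0 mA.
have mA' : measurable ((fun x : R => s * x) @^-1` A).
  by rewrite -[X in measurable X]setTI; apply: mulrl_measurable.
rewrite (normal_prob_indicE _ mA) (normal_prob_indicE _ mA').
rewrite (ge0_integral_affine 0 s0); first last.
- by move=> x; rewrite lee_fin mulr_ge0// normal_pdf_ge0.
- exact: measurable_indic_normal_pdf.
rewrite -ge0_integralZl//=.
- apply: eq_integral => x _; rewrite -EFinM addr0; congr EFin.
  rewrite mulrCA; congr (_ * _).
  rewrite std_normal_pdfE normal_pdfE ?gt_eqF// /normal_fun subr0 mulrA.
  congr (_ * expR _).
    rewrite /normal_peak expr1n mul1r -[s ^+ 2 * _ *+ 2]mulrnAr sqrtrM ?sqr_ge0//.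
    by rewrite sqrtr_sqr gtr0_norm// invfM mulVKf// gt_eqF.
  by field; rewrite gt_eqF.
- apply: measurableT_comp (measurable_indic_normal_pdf s mA) _.
  by apply: measurable_funD => //; apply: measurable_funM.
- by move=> x _; rewrite lee_fin mulr_ge0// normal_pdf_ge0.
- by rewrite lee_fin ltW.
Qed.

Lemma std_normal_rotation (c s x y : R) : c ^+ 2 + s ^+ 2 = 1 ->
  phi (c * x - s * y) * phi (c * y + s * x) = phi x * phi y.
Proof.
move=> cs; rewrite !std_normal_pdfE.
rewrite mulrACA [RHS]mulrACA -!expRD; congr (_ * expR _).
rewrite -!opprD -!mulrDl; congr (- (_ / _)).
transitivity ((c ^+ 2 + s ^+ 2) * (x ^+ 2 + y ^+ 2)); first by ring.
by rewrite cs mul1r.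
Qed.

Lemma gauss_setT : gauss setT = 1%E.
Proof. exact: integral_normal_pdf. Qed.

(** The density is even and Lebesgue measure is invariant under negation. The affine substitution
    above covers positive slopes only, so the reflection is treated by itself. *)
Lemma gaussN (A : set R) : measurable A -> gauss (-%R @^-1` A) = gauss A.
Proof.
move=> mA; have mA' : measurable (-%R @^-1` A : set R).
  by rewrite -[X in measurable X]setTI; exact: oppr_measurable.
rewrite (normal_prob_indicE _ mA) (normal_prob_indicE _ mA').
pose opp : measurableTypeR R -> measurableTypeR R := -%R.
have mN : measurable_fun setT opp by exact: oppr_measurable.
have @mirror : {measure set (measurableTypeR R) -> \bar R}.
  by refine (pushforward lebesgue_measure opp); exact: mN.
rewrite [RHS](@eq_measure_integral _ _ _ _ mirror); last first.
  by move=> C mC _; rewrite [RHS]lebesgue_measureN.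
have mphi := measurable_indic_normal_pdf 1 mA.
rewrite (ge0_integral_pushforward mN _ measurableT mphi); last first.
  by move=> x _; rewrite lee_fin mulr_ge0// normal_pdf_ge0.
rewrite preimage_setT; apply: eq_integral => x _ /=.
by rewrite !std_normal_pdfE sqrrN.
Qed.

Section rotation.
Variables (c s : R).
Hypothesis (c0 : 0 < c) (cs : c ^+ 2 + s ^+ 2 = 1).

Let measurable_linear2 (a b : R) :
  measurable_fun setT (fun z : R * R => a * z.1 + b * z.2).
Proof.
by apply: measurable_funD; apply: measurable_funM.
Qed.

Let rot (z : R * R) : R * R := (c * z.1 + s * z.2, - s * z.1 + c * z.2).

Lemma measurable_rotation : measurable_fun setT rot.
Proof.
by apply/measurable_fun_pairP; split => /=; exact: measurable_linear2.
Qed.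

(** The product density is radial and the rotation splits into two one-variable affine substitutions
    with slopes [c^-1] and [c], whose Jacobian factors cancel; this is where [0 < c] enters.
    Rectangles suffice, because [iid_normal] below is tested on boxes. *)
Lemma gauss2_rotation (A B : set R) : measurable A -> measurable B ->
  (gauss \x gauss)%E (rot @^-1` (A `*` B)) = (gauss A * gauss B)%E.
Proof.
move=> mA mB; set E := rot @^-1` _.
have mE : measurable E.
  rewrite -[X in measurable X]setTI; apply: measurable_rotation => //.
  exact: measurableX.
have indE x y : \1_E (x, y) = \1_A (c * x + s * y) * \1_B (- s * x + c * y) :> R.
  rewrite !indicE -natrM mulnb; congr (_%:R); congr nat_of_bool.
  by apply/idP/andP; rewrite !inE.
have mphi (a b : R) : measurable_fun setT (fun z : R * R => phi (a * z.1 + b * z.2)).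
  exact: measurableT_comp (measurable_normal_pdf 0 1) (measurable_linear2 a b).
have mind (C : set R) (a b : R) : measurable C ->
    measurable_fun setT (fun z : R * R => \1_C (a * z.1 + b * z.2) : R).
  by move=> mC; apply: measurableT_comp (measurable_indic mC) (measurable_linear2 a b).
pose F (z : R * R) := (\1_E z * phi z.2)%:E.
have mphi2 : measurable_fun setT (fun z : R * R => phi z.2).
  exact: measurableT_comp (measurable_normal_pdf 0 1) measurable_snd.
have mF : measurable_fun setT F.
  by apply/measurable_EFinP; apply: measurable_funM.
have F0 z : (0 <= F z)%E by rewrite lee_fin mulr_ge0// normal_pdf_ge0.
(* Only the inner measure is unfolded into its density here; the other one is unfolded once the
   order of integration has been exchanged. *)
transitivity (\int[gauss]_x \int[mu]_y F (x, y))%E.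
  apply: eq_integral => x _ /=.
  rewrite normal_prob_indicE; last exact: measurable_xsection.
  by apply: eq_integral => y _; rewrite /F !indicE mem_xsection.
rewrite (fubini_tonelli (m1 := gauss) (m2 := mu) F)//.
(* The substitution u = c x + s y for x, at fixed y; after exchanging the
   integrals, v = c y - s x is substituted at fixed u. *)
pose G (z : R * R) := (\1_A z.1 * \1_B (- (s / c) * z.1 + c^-1 * z.2)
  * phi (c^-1 * z.1 + - (s / c) * z.2) * phi z.2 * c^-1)%:E.
have mG : measurable_fun setT G.
  apply/measurable_EFinP; apply: measurable_funM => //.
  apply: measurable_funM => //; apply: measurable_funM => //.
  apply: measurable_funM; last exact: mind.
  exact: measurableT_comp (measurable_indic mA) measurable_fst.
have G0 z : (0 <= G z)%E.
  by rewrite lee_fin !mulr_ge0 ?normal_pdf_ge0// invr_ge0 ltW.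
transitivity (\int[mu]_y \int[mu]_x G (x, y))%E.
  apply: eq_integral => y _.
  transitivity (gauss (ysection E y) * (phi y)%:E)%E.
    have mEy : measurable (ysection E y) by exact: measurable_ysection.
    have -> : gauss (ysection E y) = (\int[gauss]_x (\1_(ysection E y) x)%:E)%E.
      by rewrite integral_indic// setIT.
    rewrite -ge0_integralZr//=; last 2 first.
    - by apply/measurable_EFinP/measurable_indic.
    - by rewrite lee_fin normal_pdf_ge0.
    by apply: eq_integral => x _; rewrite /F !indicE mem_ysection.
  have mEy : measurable (ysection E y) by exact: measurable_ysection.
  rewrite normal_prob_indicE//.
  have c0' : 0 < c^-1 by rewrite invr_gt0.
  rewrite (ge0_integral_affine (- (s / c) * y) c0'); first last.
  - by move=> x; rewrite lee_fin mulr_ge0// normal_pdf_ge0.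
  - exact: measurable_indic_normal_pdf.
  rewrite muleAC -ge0_integralZl//=; last first.
  - by rewrite -EFinM lee_fin mulr_ge0 ?normal_pdf_ge0// ltW.
  - by move=> x _; rewrite lee_fin mulr_ge0// normal_pdf_ge0.
  - apply: measurableT_comp (measurable_indic_normal_pdf 1 mEy) _.
    by apply: measurable_funD => //; apply: measurable_funM.
  apply: eq_integral => x _; rewrite /G -!EFinM /=; congr EFin.
  have -> : \1_(ysection E y) (c^-1 * x + - (s / c) * y) =
      \1_A x * \1_B (- (s / c) * x + c^-1 * y) :> R.
    rewrite indicE mem_ysection -indicE indE; congr (\1_A _ * \1_B _).
      by field; rewrite gt_eqF.
    transitivity (- (s / c) * x + (c ^+ 2 + s ^+ 2) / c * y).
      by field; rewrite gt_eqF.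
    by rewrite cs mul1r.
  by ring.
rewrite -(fubini_tonelli (m1 := mu) (m2 := mu) G)//.
transitivity (\int[mu]_x ((\1_A x * phi x)%:E * gauss B))%E; last first.
  rewrite ge0_integralZr//=.
  - by rewrite -normal_prob_indicE.
  - exact: measurable_indic_normal_pdf.
  - by move=> x _; rewrite lee_fin mulr_ge0// normal_pdf_ge0.
apply: eq_integral => x _.
rewrite (ge0_integral_affine (s * x) c0)//; last first.
  exact: measurable_fun_pair2.
rewrite normal_prob_indicE// -!ge0_integralZl//=.
- apply: eq_integral => y _; rewrite /G -!EFinM /=; congr EFin.
  have -> : - (s / c) * x + c^-1 * (c * y + s * x) = y.
    by field; rewrite gt_eqF.
  have -> : c^-1 * x + - (s / c) * (c * y + s * x) = c * x - s * y.
    transitivity ((1 - s ^+ 2) / c * x - s * y); first by field; rewrite gt_eqF.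
    by rewrite -cs addrK; field; rewrite gt_eqF.
  transitivity (\1_A x * \1_B y * (phi (c * x - s * y) * phi (c * y + s * x))).
    by field; rewrite gt_eqF.
  by rewrite std_normal_rotation//; ring.
- exact: measurable_indic_normal_pdf.
- by move=> y _; rewrite lee_fin mulr_ge0// normal_pdf_ge0.
- by rewrite lee_fin mulr_ge0// normal_pdf_ge0.
- apply: measurableT_comp (measurable_fun_pair2 x mG) _.
  by apply: measurable_funD => //; apply: measurable_funM.
- by rewrite lee_fin ltW.
Qed.

End rotation.

End standard_gaussian.

(** * Families of independent standard normal variables *)

Section iid_normal.
Context {R : realType} {d} {T : measurableType d} (P : probability T R).
Context {I : finType}.
Implicit Types (Z : I -> T -> R) (z u v : I -> R).
Local Notation gauss := (normal_prob (0 : R) 1).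

(** Independence and the standard normal marginals are packed into one formula on boxes; setting all
    sides but one to [setT] recovers a marginal. *)
Definition iid_normal Z : Prop :=
  (forall i, measurable_fun setT (Z i)) /\
  forall B : I -> set R, (forall i, measurable (B i)) ->
    P (\bigcap_(i in [set: I]) (Z i @^-1` B i)) =
    (\prod_i fine (gauss (B i)))%:E.

Lemma iid_normal_marginal Z i (B : set R) :
  iid_normal Z -> measurable B -> P (Z i @^-1` B) = gauss B.
Proof.
move=> [mZ ZB] mB; pose B' k := if k == i then B else setT.
have mB' k : measurable (B' k) by rewrite /B'; case: (k == i).
have -> : Z i @^-1` B = \bigcap_(k in [set: I]) (Z k @^-1` B' k).
  apply/seteqP; split=> w /= => [Bw k _|Bw].
    by rewrite /B'; case: eqVneq => [->|].
  by have := Bw i Logic.I; rewrite /B' eqxx.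
rewrite ZB// (bigD1 i)//= /B' eqxx big1 ?mulr1.
  by rewrite fineK//; apply: fin_num_measure.
by move=> k /negbTE ->; rewrite gauss_setT.
Qed.

(** As functions of [E] both sides are measures, and they agree on rectangles by [iid_normal]. The
    constant is absorbed into the first factor, so that uniqueness of product measures extends the
    equality to every measurable [E]. *)
Lemma iid_normal_pair_law Z (i j : I) (B : I -> set R) (E : set (R * R)) :
  iid_normal Z -> i != j -> (forall k, measurable (B k)) -> measurable E ->
  P ((fun w => (Z i w, Z j w)) @^-1` E `&`
     \bigcap_(k in [set k | k != i /\ k != j]) (Z k @^-1` B k)) =
  ((\prod_(k | (k != i) && (k != j)) fine (gauss (B k)))%:E *
   (gauss \x gauss) E)%E.
Proof.
move=> [mZ ZB] ij mB mE; set D := \bigcap_(k in _) _; set c := \prod_(_ | _) _.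
have mD : measurable D.
  apply: fin_bigcap_measurable; first exact: finite_finset.
  by move=> k _; rewrite -[X in measurable X]setTI; exact: mZ.
have c0 : 0 <= c by apply: prodr_ge0 => k _; exact: fine_ge0.
pose Zij : T -> measurableTypeR R * measurableTypeR R :=
  fun w => (Z i w, Z j w).
have mZij : measurable_fun setT Zij.
  by apply/measurable_fun_pairP; split; exact: mZ.
have @joint : {measure set (measurableTypeR R * measurableTypeR R) -> \bar R}.
  refine (pushforward (mrestr P mD) Zij).
  exact: mZij.
transitivity ((mscale (NngNum c0) gauss \x gauss)%E E); last first.
  rewrite /product_measure1 ge0_integral_mscale//.
  exact: measurable_fun_xsection.
rewrite -[LHS]/(joint E).
pose m1 : {sigma_finite_measure set (measurableTypeR R) -> \bar R} :=
  mscale (NngNum c0) gauss.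
apply/esym.
apply: (product_measure_unique (m1 := m1) (m2 := gauss) (m' := joint)) => //.
move=> A1 A2 mA1 mA2.
rewrite /joint /= /pushforward /mrestr.
pose B' k := if k == i then A1 else if k == j then A2 else B k.
have mB' k : measurable (B' k).
  rewrite /B'; case: (k == i); first exact: mA1.
  case: (k == j); [exact: mA2|exact: mB].
have ji : (j == i) = false by rewrite eq_sym (negbTE ij).
have -> : (fun w => (Z i w, Z j w)) @^-1` (A1 `*` A2) `&` D =
    \bigcap_(k in [set: I]) (Z k @^-1` B' k).
  apply/seteqP; split=> w /=.
    move=> [[/= A1w A2w] Dw] k _; rewrite /B' /=.
    case: eqVneq => [->//|ki]; case: eqVneq => [->//|kj].
    exact: Dw.
  move=> Bw; split; first split => /=.
  - by have := Bw i Logic.I; rewrite /B' /= eqxx.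
  - by have := Bw j Logic.I; rewrite /B' /= ji eqxx.
  - move=> k [/negbTE ki /negbTE kj]; have := Bw k Logic.I.
    by rewrite /B' /= ki kj.
rewrite ZB// (bigD1 i)//= (bigD1 j) ?ji//= /B' eqxx ji eqxx.
rewrite (eq_bigr (fun k => fine (gauss (B k)))); last first.
  by move=> k /andP[/negbTE -> /negbTE ->].
by rewrite mulrA EFinM EFinM !fineK ?fin_num_measure// muleC muleA.
Qed.

Definition givens (i j : I) (c s : R) z : I -> R := fun k =>
  if k == i then c * z i + s * z j else
  if k == j then - s * z i + c * z j else z k.

(** A box condition on the rotated family is a box condition on the untouched coordinates together
    with a rotated rectangle for the pair [(Z i, Z j)], whose mass is given by [gauss2_rotation]. *)
Lemma iid_normal_givens Z i j c s : iid_normal Z -> i != j -> 0 < c ->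
  c ^+ 2 + s ^+ 2 = 1 ->
  iid_normal (fun k w => givens i j c s (Z ^~ w) k).
Proof.
move=> iidZ ij c0 cs; have [mZ ZB] := iidZ; split=> [k|B mB].
  rewrite /givens; case: (k == i); last case: (k == j) => //.
    by apply: measurable_funD; apply: measurable_funM.
  by apply: measurable_funD; apply: measurable_funM.
have ji : (j == i) = false by rewrite eq_sym (negbTE ij).
rewrite (bigD1 i)//= (bigD1 j) ?ji//= mulrA EFinM EFinM.
have finB k : gauss (B k) \is a fin_num by apply: fin_num_measure; exact: mB.
rewrite !fineK//.
have <- := gauss2_rotation c0 cs (mB i) (mB j).
have mE := measurable_rotation c s measurableT (measurableX (mB i) (mB j)).
rewrite setTI in mE; rewrite muleC -(iid_normal_pair_law iidZ ij mB mE).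
congr (P _); apply/seteqP; split=> w /=.
  move=> Bw; split; first split => /=.
  - by have := Bw i Logic.I; rewrite /givens /= eqxx.
  - by have := Bw j Logic.I; rewrite /givens /= ji eqxx.
  - move=> k [/negbTE ki /negbTE kj]; have := Bw k Logic.I.
    by rewrite /givens /= ki kj.
move=> [[/= Biw Bjw] Dw] k _; rewrite /givens /=.
case: eqVneq => [->//|ki]; case: eqVneq => [->//|kj].
exact: Dw.
Qed.

Definition flip (i : I) z : I -> R := fun k => if k == i then - z k else z k.

Lemma iid_normal_flip Z i : iid_normal Z ->
  iid_normal (fun k w => flip i (Z ^~ w) k).
Proof.
move=> [mZ ZB]; split=> [k|B mB].
  by rewrite /flip; case: (k == i) => //; exact: measurable_funN.
pose B' k := if k == i then -%R @^-1` B k else B k.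
have mB' k : measurable (B' k).
  rewrite /B'; case: ifP => // _.
  by rewrite -[X in measurable X]setTI; exact: oppr_measurable.
transitivity (P (\bigcap_(k in [set: I]) (Z k @^-1` B' k))).
  congr (P _); apply: eq_bigcapr => k _; rewrite /flip /B'.
  by case: ifP.
rewrite ZB//; congr EFin; apply: eq_bigr => k _; rewrite /B'.
by case: ifP => // _; rewrite gaussN.
Qed.

End iid_normal.

(** * Euclidean geometry of reflections and plane rotations *)

Section dot.
Context {R : realType} {I : finType}.
Implicit Types (u v w z : I -> R) (a c s : R).

Definition dot u v : R := \sum_i u i * v i.

Lemma dotC u v : dot u v = dot v u.
Proof. by apply: eq_bigr => i _; rewrite mulrC. Qed.

Lemma dotBZr a u v w : dot u (fun k => v k - a * w k) = dot u v - a * dot u w.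
Proof.
rewrite /dot mulr_sumr -sumrB; apply: eq_bigr => i _; ring.
Qed.

Lemma dotBZl a u v w : dot (fun k => v k - a * w k) u = dot v u - a * dot w u.
Proof. by rewrite dotC dotBZr dotC (dotC u). Qed.

Lemma dot_gt0 u i : u i != 0 -> 0 < dot u u.
Proof.
move=> ui; rewrite /dot (bigD1 i)//= ltr_pwDl//.
  by rewrite -expr2 exprn_even_gt0.
by apply: sumr_ge0 => j _; rewrite -expr2 sqr_ge0.
Qed.

Lemma dot_bigD2 (i j : I) u v : i != j ->
  dot u v = u i * v i + u j * v j + \sum_(k | (k != i) && (k != j)) u k * v k.
Proof.
move=> ij; rewrite /dot (bigD1 i)//= (bigD1 j) ?addrA//=.
by rewrite eq_sym.
Qed.

Definition householder w z : I -> R :=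
  fun k => z k - 2 * dot w z / dot w w * w k.

Lemma householder_adjoint w u z :
  dot u (householder w z) = dot (householder w u) z.
Proof. by rewrite dotBZr dotBZl (dotC u w); ring. Qed.

Lemma householder_isometry w u v : dot w w != 0 ->
  dot (householder w u) (householder w v) = dot u v.
Proof.
by move=> w0; rewrite dotBZr !dotBZl (dotC u w); field.
Qed.

Lemma householder_orth w u : dot w u = 0 -> householder w u = u.
Proof.
by move=> wu; apply/funext => k; rewrite /householder wu mulr0 !mul0r subr0.
Qed.

(** Equal norms give [dot w w = - (2 * dot w v)], so the reflection adds exactly [w = u - v] to [v].
    The factor [1] brings [w] into the shape required by [dotBZl] and [dotBZr]. *)
Lemma householder_swap u v : dot u u = dot v v ->
  let w := fun k => u k - 1 * v k in dot w w != 0 -> householder w v = u.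
Proof.
move=> uv w w0; apply/funext => k.
have ww : dot w w = - (2 * dot w v).
  by rewrite dotBZr !dotBZl uv (dotC u v); ring.
have wv0 : dot w v != 0 by apply: contraNneq w0 => wv; rewrite ww wv mulr0 oppr0.
by rewrite /householder ww /w; field.
Qed.

Lemma householderN w : householder (fun k => - w k) = householder w.
Proof.
apply/funext => z; apply/funext => k.
have dotN v : dot (fun k => - w k) v = - dot w v.
  by rewrite /dot -sumrN; apply: eq_bigr => i _; rewrite mulNr.
have dotNN : dot (fun k => - w k) (fun k => - w k) = dot w w.
  by apply: eq_bigr => i _; rewrite mulrNN.
rewrite /householder dotNN dotN.
by ring.
Qed.

Lemma givens_isometry (i j : I) c s u v : i != j -> c ^+ 2 + s ^+ 2 = 1 ->
  dot (givens i j c s u) (givens i j c s v) = dot u v.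
Proof.
move=> ij cs; have ji : (j == i) = false by rewrite eq_sym (negbTE ij).
rewrite !(dot_bigD2 _ _ ij); congr (_ + _).
  rewrite /givens !eqxx ji.
  transitivity ((c ^+ 2 + s ^+ 2) * (u i * v i + u j * v j)); first by ring.
  by rewrite cs mul1r.
by apply: eq_bigr => k /andP[/negbTE ki /negbTE kj]; rewrite /givens ki kj.
Qed.

Lemma givensK (i j : I) c s : i != j -> c ^+ 2 + s ^+ 2 = 1 ->
  cancel (givens i j c s) (givens i j c (- s)).
Proof.
move=> ij cs z; have ji : (j == i) = false by rewrite eq_sym (negbTE ij).
apply/funext => k; rewrite /givens !eqxx ji.
case: eqVneq => [->|_].
  by transitivity ((c ^+ 2 + s ^+ 2) * z i); [ring|rewrite cs mul1r].
case: eqVneq => [->|//].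
by transitivity ((c ^+ 2 + s ^+ 2) * z j); [ring|rewrite cs mul1r].
Qed.

Lemma givensBZ (i j : I) c s a u v :
  givens i j c s (fun k => u k - a * v k) =
  (fun k => givens i j c s u k - a * givens i j c s v k).
Proof.
apply/funext => k; rewrite /givens.
by case: ifP => _; [ring|case: ifP => _ //; ring].
Qed.

(* Conjugating a reflection by a rotation that annihilates an entry of [w]
   reduces its support. *)
Lemma householder_givens (i j : I) c s w z : i != j -> c ^+ 2 + s ^+ 2 = 1 ->
  givens i j c (- s) (householder (givens i j c s w) (givens i j c s z)) =
  householder w z.
Proof.
by move=> ij cs; rewrite /householder givensBZ !givens_isometry// !givensK.
Qed.

End dot.

(** * Invariance of the standard normal law under products of reflections *)

Section gaussian_preserving.
Context {R : realType} {d} {T : measurableType d} (P : probability T R).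
Context {I : finType}.
Implicit Types (u v z : I -> R).

Definition iid_normal_preserving (g : (I -> R) -> I -> R) : Prop :=
  forall Z, iid_normal P Z -> iid_normal P (fun k w => g (Z ^~ w) k).

Lemma iid_normal_preserving_comp g h : iid_normal_preserving g ->
  iid_normal_preserving h -> iid_normal_preserving (g \o h).
Proof. by move=> gP hP Z iidZ; apply: (gP _ (hP _ iidZ)). Qed.

(** Induction on the number of nonzero entries of [w] other than [w i]. If there is none, the
    reflection is the sign flip of coordinate [i]; otherwise a rotation moves the mass of some [w j]
    into [w i]. Positivity of [w i] makes the cosine of that rotation positive. *)
Lemma householder_preserving_pos (i : I) w : 0 < w i ->
  iid_normal_preserving (householder w).
Proof.
have [n] := ubnP #|[pred k | (k != i) && (w k != 0)]|.
elim: n w => // n IH w; rewrite ltnS => wn wi.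
have [j /andP[ji wj]|w0] := pickP (fun k => (k != i) && (w k != 0)); last first.
  suff -> : householder w = flip i by move=> Z; exact: iid_normal_flip.
  have wk k : k != i -> w k = 0.
    by move=> ki; have := w0 k; rewrite ki => /negbFE/eqP.
  have dotw v : dot w v = w i * v i.
    by rewrite /dot (bigD1 i)//= big1 ?addr0// => k /wk ->; rewrite mul0r.
  apply/funext => z; apply/funext => k; rewrite /householder !dotw /flip.
  case: eqVneq => [->|/wk ->]; last by rewrite mulr0 subr0.
  by field; rewrite gt_eqF.
have ij : i != j by rewrite eq_sym.
pose r := Num.sqrt (w i ^+ 2 + w j ^+ 2).
have r2 : r ^+ 2 = w i ^+ 2 + w j ^+ 2 by rewrite sqr_sqrtr// addr_ge0// sqr_ge0.
have r0 : 0 < r by rewrite sqrtr_gt0 ltr_pwDl ?sqr_ge0// exprn_gt0.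
pose c := w i / r; pose s := w j / r.
have cs : c ^+ 2 + s ^+ 2 = 1.
  by rewrite !expr_div_n -mulrDl -r2 divff// expf_neq0// gt_eqF.
have c0 : 0 < c by rewrite divr_gt0.
have -> : householder w = givens i j c (- s) \o
    (householder (givens i j c s w) \o givens i j c s).
  by apply/funext => z; rewrite /= householder_givens.
have gi : givens i j c s w i = r.
  rewrite /givens eqxx; transitivity (r ^+ 2 / r); last by field; rewrite gt_eqF.
  by rewrite r2 /c /s; ring.
have gj : givens i j c s w j = 0.
  by rewrite /givens (negbTE ji) eqxx /c /s; ring.
apply: iid_normal_preserving_comp.
  by move=> Z iidZ; apply: iid_normal_givens => //; rewrite sqrrN.
apply: iid_normal_preserving_comp; last first.
  by move=> Z iidZ; exact: iid_normal_givens.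
apply: IH; last by rewrite gi.
(* The rotated vector vanishes at [j] and is unchanged away from [i] and [j], so its support off [i]
   is strictly smaller. *)
apply: leq_trans wn; apply: proper_card; apply/properP; split.
  apply/fintype.subsetP => k; rewrite !inE => /andP[ki gk]; rewrite ki /=.
  move: gk; rewrite /givens (negbTE ki); case: (eqVneq k j) => // ->.
  by rewrite wj.
by exists j; rewrite !inE ji ?wj//= gj eqxx.
Qed.

(** Some entry of [w] is nonzero; if it is negative, [- w] defines the same reflection and has a
    positive entry there. *)
Lemma householder_preserving w : dot w w != 0 ->
  iid_normal_preserving (householder w).
Proof.
move=> ww; have [i wi] : exists i, w i != 0.
  apply/existsP; apply: contraNT ww; rewrite negb_exists => /forallP w0.
  by rewrite /dot big1// => i _; have /negbNE/eqP -> := w0 i; rewrite mul0r.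
have [wi0|wi0] := ltP 0 (w i); first exact: householder_preserving_pos wi0.
rewrite -householderN; apply: (householder_preserving_pos (i := i)).
by rewrite oppr_gt0 lt_neqAle wi.
Qed.

(** The rows are matched one at a time, each by one more reflection. Equality of the Gram matrices
    makes the new reflection fix the rows matched before. *)
Lemma equal_gram_preserving (J : finType) (A1 A2 : J -> I -> R) :
  (forall j k, dot (A1 j) (A1 k) = dot (A2 j) (A2 k)) ->
  exists2 g, iid_normal_preserving g &
    forall j z, dot (A2 j) (g z) = dot (A1 j) z.
Proof.
move=> gram.
(* [gt] is the transpose of [g]: it moves the rows while [g] moves the random vector. Its isometry
   property is carried along for the induction step. *)
suff [g [gt [gP gadj _ gtA]]] : exists g gt, [/\ iid_normal_preserving g,
    (forall u z, dot u (g z) = dot (gt u) z),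
    (forall u v, dot (gt u) (gt v) = dot u v) &
    forall j, j \in enum J -> gt (A2 j) = A1 j].
  by exists g => // j z; rewrite gadj gtA// mem_enum.
elim: (enum J) => [|a s [g [gt [gP gadj giso gtA]]]].
  by exists id, id; split => // Z.
pose v := gt (A2 a); pose w k := A1 a k - 1 * v k.
(* A vanishing [w] means that row [a] is matched already, and no reflection is added. *)
have [ww|ww] := eqVneq (dot w w) 0.
  exists g, gt; split => // j; rewrite inE => /predU1P[->|/gtA//].
  apply/funext => k; apply/eqP; rewrite eq_sym -subr_eq0 -[gt _ k]mul1r.
  by apply: contraTT isT => /(@dot_gt0 _ _ w); rewrite ww ltxx.
exists (g \o householder w), (householder w \o gt); split.
- exact: iid_normal_preserving_comp gP (householder_preserving ww).
- by move=> u z /=; rewrite gadj householder_adjoint.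
- by move=> u u' /=; rewrite householder_isometry.
- move=> j; rewrite inE => /predU1P[->|js] /=.
    by apply: householder_swap => //; rewrite giso.
  (* Earlier rows are orthogonal to [w]: the products of [A1 j] with [A1 a] and with [v] both equal
     the Gram entry of [a] and [j]. *)
  rewrite gtA// householder_orth// dotBZl gram -(gtA _ js) giso.
  by rewrite mul1r subrr.
Qed.

End gaussian_preserving.

(** * Gaussian mass of planar wedges *)

Section wedge.
Context {R : realType}.
Local Notation mu := (@lebesgue_measure R).
Local Notation gauss := (normal_prob (0 : R) 1).

Lemma gauss_itv_gt0 (a b : R) : a < b -> (0 < gauss `[a, b]%classic)%E.
Proof.
(* The density is at least [m] on the interval, since [x ^+ 2 <= a ^+ 2 + b ^+ 2] there whatever the
   signs of the endpoints. *)
move=> ab; pose m : R := normal_peak 1 * expR (- ((a ^+ 2 + b ^+ 2) / 2)).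
have m0 : 0 < m by rewrite mulr_gt0 ?expR_gt0 ?normal_peak_gt0 ?oner_eq0.
apply: (@lt_le_trans _ _ (\int[mu]_(x in `[a, b]) m%:E)%E).
  rewrite integral_cst//= lebesgue_measure_itv /= lte_fin ab -EFinB -EFinM lte_fin.
  by rewrite mulr_gt0// subr_gt0.
apply: ge0_le_integral => //=.
- by move=> x _; rewrite lee_fin ltW.
- by apply/measurable_EFinP/measurable_funTS; exact: measurable_normal_pdf.
- move=> x; rewrite in_itv /= => /andP[ax xb].
  rewrite lee_fin std_normal_pdfE ler_pM2l ?normal_peak_gt0 ?oner_eq0//.
  rewrite ler_expR lerN2 ler_pM2r ?invr_gt0//.
  have [x0|x0] := lerP 0 x.
    by rewrite ler_wpDl ?sqr_ge0// lerXn2r// nnegrE (le_trans x0).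
  rewrite ler_wpDr ?sqr_ge0// -sqrrN -(sqrrN a) lerXn2r// ?nnegrE; lra.
Qed.

(** An intersection of two half-planes with normals [(1, 0)] and [(t, 1)]; [t] is the cotangent of
    the angle between these normals. *)
Definition wedge (t : R) : set (R * R) := [set z | 0 <= z.1 /\ 0 <= t * z.1 + z.2].

Lemma measurable_wedge t : measurable (wedge t).
Proof.
have -> : wedge t = (fst @^-1` `[0, +oo[) `&`
    ((fun z => t * z.1 + z.2) @^-1` `[0, +oo[).
  by apply/seteqP; split=> z /=; rewrite !in_itv /= !andbT.
apply: measurableI; rewrite -[X in measurable X]setTI.
  exact: measurable_fst.
have mf : measurable_fun setT (fun z : R * R => t * z.1 + z.2).
  by apply: measurable_funD => //; apply: measurable_funM.
exact: mf.
Qed.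

(** Since [z.1 >= 0], the wedge grows with [t]; strictness comes from a square of positive mass
    inside the difference. *)
Lemma gauss2_wedge_lt (t1 t2 : R) : t1 < t2 ->
  ((gauss \x gauss) (wedge t1) < (gauss \x gauss) (wedge t2))%E.
Proof.
move=> t12.
(* A far enough unit square between the lines y = - t2 x and y = - t1 x. *)
pose x0 := (`|t1| + `|t2| + 2) / (t2 - t1); pose y0 := - t2 * x0 + `|t2|.
pose Q : set (R * R) := `[x0, x0 + 1]%classic `*` `[y0, y0 + 1]%classic.
(* This is the vertical gap between the two lines at [x0]. It pays for lifting the square by [|t2|],
   for a descent of the upper line by at most [|t1|] over unit width, for the height 1 of the
   square, and leaves 1 to spare. *)
have x0t : (t2 - t1) * x0 = `|t1| + `|t2| + 2.
  by rewrite mulrC divfK// subr_eq0 gt_eqF.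
have x00 : 0 < x0.
  by rewrite divr_gt0 ?subr_gt0// ltr_wpDl// addr_ge0.
have mQ : measurable Q by exact: measurableX.
have QI : wedge t1 `&` Q = set0.
  apply/seteqP; split=> // -[x y] [[/= xge tge]] [/=].
  rewrite !in_itv /= => /andP[x1 x2] /andP[y1 y2].
  have : t1 * (x - x0) <= `|t1|.
    apply: le_trans (ler_norm _) _; rewrite normrM ler_piMr// ger0_norm; lra.
  rewrite /y0 in y1 y2; nra.
have QU : wedge t1 `|` Q `<=` wedge t2.
  move=> [x y] [[/= xge tge]|[/=]]; first by split=> //=; nra.
  rewrite !in_itv /= => /andP[x1 x2] /andP[y1 y2]; split=> /=; first lra.
  have : - (t2 * (x - x0)) <= `|t2|.
    apply: le_trans (ler_norm _) _; rewrite normrN normrM ler_piMr// ger0_norm; lra.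
  rewrite /y0 in y1 y2; nra.
have Q0 : (0 < (gauss \x gauss) Q)%E.
  by rewrite product_measure1E// mule_gt0// gauss_itv_gt0// ltrDl.
have mW := measurable_wedge.
(* Finiteness is what makes adding positive mass a strict increase in the extended reals. *)
have fin1 : (gauss \x gauss)%E (wedge t1) \is a fin_num.
  rewrite ge0_fin_numE; last exact: measure_ge0.
  apply: (@le_lt_trans _ _ ((gauss \x gauss) setT)%E).
    by apply: le_measure; rewrite ?inE; [exact: mW|exact: measurableT|].
  by rewrite -setXTT product_measure1E//= lte_mul_pinfty// ?gauss_setT ?ltry.
apply: (@lt_le_trans _ _ ((gauss \x gauss) (wedge t1 `|` Q))%E).
  rewrite measureU//; first by rewrite lteDl.
  exact: mW.
apply: le_measure; rewrite ?inE; [|exact: mW|exact: QU].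
exact: measurableU (mW _) mQ.
Qed.

End wedge.

(** * Correlations recovered from orthant probabilities *)

Section orthant.
Context {R : realType} {I : finType}.
Local Notation gauss := (normal_prob (0 : R) 1).

Lemma gauss2_wedge_inj (t1 t2 : R) :
  (gauss \x gauss)%E (wedge t1) = (gauss \x gauss)%E (wedge t2) -> t1 = t2.
Proof.
move=> e; apply/eqP; rewrite eq_le !leNgt.
apply/andP; split; apply/negP => t12; have := gauss2_wedge_lt t12.
  by rewrite e ltxx.
by rewrite -e ltxx.
Qed.

(** Only the Gram matrix of [u] and [v] matters, so both can be moved into the plane of the
    coordinates [i] and [j], where the event is a wedge. The strict bound on [dot u v] excludes
    parallel vectors and keeps the square root positive. *)
Lemma orthant_prob d (T : measurableType d) (P : probability T R)
    (Z : I -> T -> R) (u v : I -> R) (r : R) (i j : I) :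
  iid_normal P Z -> i != j -> 0 < r -> dot u u = r -> dot v v = r ->
  dot u v ^+ 2 < r ^+ 2 ->
  P [set w | 0 <= dot u (Z ^~ w) /\ 0 <= dot v (Z ^~ w)] =
  (gauss \x gauss)%E (wedge (dot u v / Num.sqrt (r ^+ 2 - dot u v ^+ 2))).
Proof.
move=> iidZ ij r0 uu vv; set q := dot u v => qr.
have ji : (j == i) = false by rewrite eq_sym (negbTE ij).
have s0 : 0 < Num.sqrt (r ^+ 2 - q ^+ 2) by rewrite sqrtr_gt0 subr_gt0.
have s2 : Num.sqrt (r ^+ 2 - q ^+ 2) ^+ 2 = r ^+ 2 - q ^+ 2.
  by rewrite sqr_sqrtr// subr_ge0 ltW.
move: s0 s2; set s := Num.sqrt (r ^+ 2 - q ^+ 2) => s0 s2.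
have k0 : 0 < Num.sqrt r by rewrite sqrtr_gt0.
have k2 : Num.sqrt r ^+ 2 = r by rewrite sqr_sqrtr// ltW.
move: k0 k2; set k := Num.sqrt r => k0 k2.
(* The Gram matrix of [u], [v] is that of vectors supported on [i], [j]. *)
pose e x y : I -> R := fun l => if l == i then x else if l == j then y else 0.
have dote x y z : dot (e x y) z = x * z i + y * z j.
  rewrite (dot_bigD2 _ _ ij) big1 ?addr0.
    by rewrite /e !eqxx ji.
  by move=> l /andP[/negbTE li /negbTE lj]; rewrite /e li lj mul0r.
have ei x y : e x y i = x by rewrite /e eqxx.
have ej x y : e x y j = y by rewrite /e ji eqxx.
pose A1 (b : bool) := if b then u else v.
(* With [k ^+ 2 = r], the vector [(q / k, s / k)] has product [q] with [(k, 0)] and squared norm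
   [(q ^+ 2 + s ^+ 2) / r = r]. *)
pose A2 (b : bool) := if b then e k 0 else e (q / k) (s / k).
have kn0 : k != 0 by rewrite gt_eqF.
have gram b c : dot (A1 b) (A1 c) = dot (A2 b) (A2 c).
  have qk : q = k * (q / k) by field.
  have vk : r = q / k * (q / k) + s / k * (s / k).
    transitivity ((q ^+ 2 + s ^+ 2) / k ^+ 2); last by field.
    by rewrite s2 k2; field; rewrite gt_eqF.
  case: b; case: c; rewrite /A1 /A2 dote ?ei ?ej ?uu ?vv ?(dotC v u) -/q.
  - by rewrite -k2 mul0r addr0 expr2.
  - by rewrite mul0r addr0.
  - by rewrite mulr0 addr0 mulrC.
  - exact: vk.
have [g gP gA] := equal_gram_preserving P gram.
pose Z' l w := g (Z ^~ w) l.
have iidZ' : iid_normal P Z' by exact: gP.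
have uE w : dot u (Z ^~ w) = k * Z' i w.
  by have := gA true (Z ^~ w); rewrite /A1 /A2 dote mul0r addr0 => <-.
have vE w : dot v (Z ^~ w) = s / k * (q / s * Z' i w + Z' j w).
  have := gA false (Z ^~ w); rewrite /A1 /A2 dote => <-.
  by rewrite /Z'; field; rewrite kn0 gt_eqF.
have := iid_normal_pair_law iidZ' ij (fun=> measurableT) (measurable_wedge (q / s)).
rewrite big1 ?mul1e => [<-|l _]; last by rewrite gauss_setT.
congr (P _); apply/seteqP; split=> w /=; rewrite uE vE !pmulr_rge0 ?divr_gt0//.
by case.
Qed.

(** The cotangent [t] determines the cosine [q / r] as [t / Num.sqrt (1 + t ^+ 2)]. *)
Lemma ratio_sqrt_inj (q1 r1 q2 r2 : R) : 0 < r1 -> 0 < r2 ->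
  q1 ^+ 2 < r1 ^+ 2 -> q2 ^+ 2 < r2 ^+ 2 ->
  q1 / Num.sqrt (r1 ^+ 2 - q1 ^+ 2) = q2 / Num.sqrt (r2 ^+ 2 - q2 ^+ 2) ->
  q1 / r1 = q2 / r2.
Proof.
suff key (q r : R) : 0 < r -> q ^+ 2 < r ^+ 2 ->
    let t := q / Num.sqrt (r ^+ 2 - q ^+ 2) in q / r = t / Num.sqrt (1 + t ^+ 2).
  by move=> r10 r20 q1r q2r e; rewrite (key _ _ r10 q1r) (key _ _ r20 q2r) /= e.
move=> r0 qr t.
have s0 : 0 < Num.sqrt (r ^+ 2 - q ^+ 2) by rewrite sqrtr_gt0 subr_gt0.
have s2 : Num.sqrt (r ^+ 2 - q ^+ 2) ^+ 2 = r ^+ 2 - q ^+ 2.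
  by rewrite sqr_sqrtr// subr_ge0 ltW.
rewrite /t; move: s0 s2; set s := Num.sqrt (r ^+ 2 - q ^+ 2) => s0 s2.
have -> : 1 + (q / s) ^+ 2 = (r / s) ^+ 2.
  transitivity ((s ^+ 2 + q ^+ 2) / s ^+ 2); first by field; rewrite gt_eqF.
  by rewrite s2 subrK expr_div_n -s2.
rewrite sqrtr_sqr gtr0_norm ?divr_gt0//; field.
by rewrite !gt_eqF.
Qed.

Lemma orthant_prob_inj d1 (T1 : measurableType d1) (P1 : probability T1 R)
    d2 (T2 : measurableType d2) (P2 : probability T2 R)
    (Z1 : I -> T1 -> R) (Z2 : I -> T2 -> R)
    (u1 v1 u2 v2 : I -> R) (r1 r2 : R) (i j : I) :
  iid_normal P1 Z1 -> iid_normal P2 Z2 -> i != j -> 0 < r1 -> 0 < r2 ->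
  dot u1 u1 = r1 -> dot v1 v1 = r1 -> dot u1 v1 ^+ 2 < r1 ^+ 2 ->
  dot u2 u2 = r2 -> dot v2 v2 = r2 -> dot u2 v2 ^+ 2 < r2 ^+ 2 ->
  P1 [set w | 0 <= dot u1 (Z1 ^~ w) /\ 0 <= dot v1 (Z1 ^~ w)] =
  P2 [set w | 0 <= dot u2 (Z2 ^~ w) /\ 0 <= dot v2 (Z2 ^~ w)] ->
  dot u1 v1 / r1 = dot u2 v2 / r2.
Proof.
move=> iid1 iid2 ij r10 r20 uu1 vv1 uv1 uu2 vv2 uv2.
have e1 := orthant_prob iid1 ij r10 uu1 vv1 uv1.
have e2 := orthant_prob iid2 ij r20 uu2 vv2 uv2.
move=> e12; have tE := etrans (etrans (esym e1) e12) e2.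
apply: (ratio_sqrt_inj r10 r20 uv1 uv2).
exact: gauss2_wedge_inj tE.
Qed.

End orthant.

(** * Real coordinates of the data as linear forms in the latent variables *)

Section model.
Context {R : realType} (K M N : nat).
Implicit Types (pos : 'I_M -> int) (th p : 'I_K -> R).
Local Notation J := ('I_M * 'I_N * bool)%type.
Local Notation L := (latent K M N).

Definition entry (j : J) (Y : 'M[R[i]]_(M, N)) : R :=
  let: (m, t, b) := j in if b then complex.Im (Y m t) else complex.Re (Y m t).

Lemma entry_inj X Y : (forall j, entry j X = entry j Y) -> X = Y.
Proof.
move=> XY; apply/matrixP => m t.
have := XY (m, t, false); have := XY (m, t, true); rewrite /entry /=.
by case: (X m t) => a b; case: (Y m t) => a' b' /= -> ->.
Qed.

(* Real form of (cos x + i sin x) times a complex source; the flags [b] and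
   [b'] are [true] for imaginary parts. *)
Definition coef pos th (j : J) (l : L) : R :=
  let: (m, t, b) := j in
  match l with
  | inl (k, t', b') =>
      if t' != t then 0 else
      let x := pi * sin (th k) * (pos m)%:~R in
      if b == b' then cos x else if b then sin x else - sin x
  | inr j' => (j' == j)%:R
  end.

Definition stddev p (s2 : R) (l : L) : R :=
  match l with
  | inl (k, _, _) => Num.sqrt (p k / 2)
  | inr _ => Num.sqrt (s2 / 2)
  end.

Lemma stddev_gt0 p (s2 : R) l : (forall k, 0 < p k) -> 0 < s2 -> 0 < stddev p s2 l.
Proof.
by move=> p0 s0; case: l => [[[k t] b]|j] /=; rewrite sqrtr_gt0 divr_gt0.
Qed.

Lemma stddev_scale (c : R) p (s2 : R) l : 0 <= c ->
  stddev (fun k => c * p k) (c * s2) l = Num.sqrt c * stddev p s2 l.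
Proof.
by move=> c0; case: l => [[[k t] b]|j] /=; rewrite -mulrA sqrtrM.
Qed.

(** These are the coefficients relative to the standardized latent variables, which form an
    [iid_normal] family. *)
Definition data_row pos th p (s2 : R) (j : J) (l : L) : R :=
  coef pos th j l * stddev p s2 l.

Lemma sum_latent (F : L -> R) :
  \sum_l F l = \sum_k \sum_t (F (inl (k, t, false)) + F (inl (k, t, true))) +
               \sum_j F (inr j).
Proof.
rewrite big_sumType /=; congr (_ + _).
rewrite pair_bigA /=.
rewrite [RHS](eq_bigr (fun q => \sum_b F (inl (q, b)))); last first.
  by move=> [k t] _; rewrite big_bool /= addrC.
by rewrite pair_bigA; apply: eq_bigr => -[[k t] b].
Qed.

Lemma sum_latent_source (F : L -> R) (t : 'I_N) :
  (forall k t' b, t' != t -> F (inl (k, t', b)) = 0) ->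
  \sum_l F l = \sum_k (F (inl (k, t, false)) + F (inl (k, t, true))) +
               \sum_j F (inr j).
Proof.
move=> F0; rewrite sum_latent; congr (_ + _); apply: eq_bigr => k _.
rewrite (bigD1 t)//= [X in _ + X]big1 ?addr0// => t' tt'.
by rewrite !F0// addr0.
Qed.

Lemma sum_noise (F : J -> R) (j : J) : \sum_j' (j' == j)%:R * F j' = F j.
Proof.
rewrite (bigD1 j)//= eqxx mul1r big1 ?addr0// => j' /negbTE ->.
by rewrite mul0r.
Qed.

Lemma entry_dataY pos th T (W : L -> T -> R) w j :
  entry j (dataY pos th W w) = dot (coef pos th j) (W ^~ w).
Proof.
case: j => [[m t] b].
have ReS (F : 'I_K -> R[i]) : complex.Re (\sum_k F k) = \sum_k complex.Re (F k).
  by apply: (big_morph (@complex.Re R)) => // -[? ?] [? ?].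
have ImS (F : 'I_K -> R[i]) : complex.Im (\sum_k F k) = \sum_k complex.Im (F k).
  by apply: (big_morph (@complex.Im R)) => // -[? ?] [? ?].
have ReD (x y : R[i]) : complex.Re (x + y) = complex.Re x + complex.Re y.
  by case: x y => ? ? [].
have ImD (x y : R[i]) : complex.Im (x + y) = complex.Im x + complex.Im y.
  by case: x y => ? ? [].
rewrite /dot (sum_latent_source (t := t)); last first.
  by move=> k t' b' tt' /=; rewrite tt' mul0r.
rewrite /= (sum_noise (fun j => W (inr j) w)) eqxx /=.
rewrite /dataY !mxE; case: b => /=.
  rewrite ImD ImS; congr (_ + _).
  by apply: eq_bigr => k _; rewrite !mxE /steer /=; ring.
rewrite ReD ReS; congr (_ + _).
by apply: eq_bigr => k _; rewrite !mxE /steer /=; ring.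
Qed.

Lemma dot_coef_stddev pos th p (s2 : R) j (z : L -> R) :
  dot (coef pos th j) (fun l => stddev p s2 l * z l) =
  dot (data_row pos th p s2 j) z.
Proof. by apply: eq_bigr => l _; rewrite mulrA. Qed.

(** The common variance of all real coordinates of [dataY]; the halves come from splitting each
    complex variance between real and imaginary parts. *)
Definition power p (s2 : R) : R := (\sum_k p k + s2) / 2.

(** Each source contributes [cos ^+ 2 + sin ^+ 2 = 1] times half its power, so neither the angles
    nor the sensor positions survive. *)
Lemma dot_data_row_diag pos th p (s2 : R) j : (forall k, 0 < p k) -> 0 < s2 ->
  dot (data_row pos th p s2 j) (data_row pos th p s2 j) = power p s2.
Proof.
move=> p0 s0; case: j => [[m t] b].
rewrite /dot (sum_latent_source (t := t)); last first.
  by move=> k t' b' tt'; rewrite /data_row /= tt' !mul0r.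
have sq (x : R) : 0 < x -> Num.sqrt (x / 2) ^+ 2 = x / 2.
  by move=> x0; rewrite sqr_sqrtr// ltW// divr_gt0.
rewrite /power mulrDl mulr_suml; congr (_ + _).
  apply: eq_bigr => k _; rewrite /data_row /= eqxx /= -[RHS](sq _ (p0 k)).
  set x := pi * _ * _; have := cos2Dsin2 x; set c := cos x; set s := sin x.
  by move=> cs; rewrite -[RHS]mul1r -cs; case: b => /=; ring.
under eq_bigr do rewrite /data_row /= -mulrA.
by rewrite sum_noise eqxx mul1r -expr2 sq.
Qed.

Lemma power_gt0 p (s2 : R) : (forall k, 0 < p k) -> 0 < s2 -> 0 < power p s2.
Proof.
move=> p0 s0; rewrite divr_gt0// ltr_wpDl//.
by apply: sumr_ge0 => k _; rewrite ltW.
Qed.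

(** Strict Cauchy-Schwarz: the noise variable of coordinate [j] enters row [j] and not row [k], so
    [u - a v] is never zero. Taking [a = 1] and [a = -1] bounds the product strictly on both
    sides. *)
Lemma dot_data_row_offdiag pos th p (s2 : R) j k : (forall k, 0 < p k) -> 0 < s2 ->
  j != k ->
  dot (data_row pos th p s2 j) (data_row pos th p s2 k) ^+ 2 < power p s2 ^+ 2.
Proof.
move=> p0 s0 jk.
have pos_dist a : 0 < power p s2 + a * a * power p s2 -
    2 * a * dot (data_row pos th p s2 j) (data_row pos th p s2 k).
  set u := data_row pos th p s2 j; set v := data_row pos th p s2 k.
  have : 0 < dot (fun l => u l - a * v l) (fun l => u l - a * v l).
    apply: (@dot_gt0 _ _ _ (inr j)); rewrite /u /v /data_row.
    have -> : coef pos th k (inr j) = 0.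
      by case: k jk @v => [[m t] b] /= /negbTE ->.
    have -> : coef pos th j (inr j) = 1.
      by case: j jk @u => [[m t] b] /=; rewrite eqxx.
    by rewrite mul1r mul0r mulr0 subr0 gt_eqF// stddev_gt0.
  rewrite dotBZr !dotBZl (dotC v u) /u /v !dot_data_row_diag// -/u -/v.
  by congr (0 < _); ring.
have := pos_dist 1; have := pos_dist (-1); have := power_gt0 p0 s0.
set r := power p s2; set q := dot _ _ => r0 h1 h2.
rewrite -subr_gt0 subr_sqr mulr_gt0//; lra.
Qed.

Lemma realization_iid p (s2 : R) d (T : measurableType d) (P : probability T R)
    (W : L -> T -> R) :
  (forall k, 0 < p k) -> 0 < s2 -> realization p s2 P W ->
  iid_normal P (fun l w => (stddev p s2 l)^-1 * W l w).
Proof.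
move=> p0 s0 [[mW indW] gW nW].
have sd0 l := stddev_gt0 l p0 s0.
have lawW l : gauss_law P (W l) (stddev p s2 l).
  by case: l => [[[k t] b]|[[m t] b]]; [exact: gW|exact: nW].
split=> [l|B mB]; first exact: measurable_funM.
pose B' l := (fun x : R => (stddev p s2 l)^-1 * x) @^-1` B l.
have mB' l : measurable (B' l).
  by rewrite -[X in measurable X]setTI; apply: mulrl_measurable.
have mI : measurable (\bigcap_(l in [set: L]) (W l @^-1` B' l)).
  apply: fin_bigcap_measurable; first exact: finite_finset.
  by move=> l _; rewrite -[X in measurable X]setTI; apply: mW.
(* [mutually_independent] equates real numbers [fine (P _)]; finiteness of [P] restores the
   extended-real equality. *)
rewrite -[LHS](@fineK _ (P (\bigcap_(l in [set: L]) (W l @^-1` B' l)))); last first.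
  exact: fin_num_measure.
rewrite indW//; congr EFin; apply: eq_bigr => l _; congr fine.
rewrite (lawW l _ (mB' l)) (normal_prob_scale (sd0 l) (mB' l)).
congr (normal_prob 0 1 _).
by apply/funext => x; rewrite /B' /= mulKf// gt_eqF.
Qed.

Lemma iid_realization p (s2 : R) d (T : measurableType d) (P : probability T R)
    (Z : L -> T -> R) :
  (forall k, 0 < p k) -> 0 < s2 -> iid_normal P Z ->
  realization p s2 P (fun l w => stddev p s2 l * Z l w).
Proof.
move=> p0 s0 iidZ; have [mZ ZB] := iidZ.
have sd0 l := stddev_gt0 l p0 s0.
pose B' (B : L -> set R) l := (fun x : R => stddev p s2 l * x) @^-1` B l.
have mB' B : (forall l, measurable (B l)) -> forall l, measurable (B' B l).
  by move=> mB l; rewrite -[X in measurable X]setTI; apply: mulrl_measurable.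
have law l : gauss_law P (fun w => stddev p s2 l * Z l w) (stddev p s2 l).
  move=> B mB; rewrite normal_prob_scale//.
  rewrite -(iid_normal_marginal l iidZ)//.
  exact: (mB' (fun=> B) (fun=> mB) l).
split; [split|by move=> k t b; exact: (law (inl (k, t, b)))|
  by move=> m t b; exact: (law (inr (m, t, b)))].
  by move=> l; exact: measurable_funM.
move=> B mB; transitivity (fine (P (\bigcap_(l in [set: L]) (Z l @^-1` B' B l)))).
  by [].
rewrite ZB; last exact: mB'.
by apply: eq_bigr => l _; rewrite (law l _ (mB l)) (normal_prob_scale (sd0 l) (mB l)).
Qed.

End model.

(** * Passing between the laws of the unquantized and the one-bit data *)

Section laws.
Context {R : realType} (K M N : nat).
Implicit Types (pos : 'I_M -> int) (th p : 'I_K -> R).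
Local Notation J := ('I_M * 'I_N * bool)%type.
Local Notation L := (latent K M N).

Lemma measurable_sgnr_level (c : R) :
  measurable [set y : R | sgnr y / Num.sqrt 2 = c].
Proof.
have sgnrE : sgnr = (fun y : R => 2 * \1_`[0, +oo[ y - 1) :> (R -> R).
  apply/funext => y; rewrite /sgnr indicE mem_setE in_itv /= andbT.
  by case: (0 <= y); rewrite ?mulr1 ?mulr0 ?sub0r//; ring.
have mf : measurable_fun setT (fun y : R => sgnr y / Num.sqrt 2).
  rewrite sgnrE; apply: measurable_funM => //; apply: measurable_funB => //.
  by apply: measurable_funM => //; apply: measurable_indic.
have := mf measurableT [set c] (measurable_set1 c).
by rewrite setTI.
Qed.

Lemma measurable_entry_dataY pos th d (T : measurableType d)
    (W : L -> T -> R) (j : J) : (forall l, measurable_fun setT (W l)) ->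
  measurable_fun setT (fun w => entry j (dataY pos th W w)).
Proof.
move=> mW; under eq_fun do rewrite entry_dataY.
by apply: measurable_sum => l; apply: measurable_funM.
Qed.

Lemma dataX_eqP pos th T (W : L -> T -> R) w (x : 'M[R[i]]_(M, N)) :
  dataX pos th W w = x <->
  forall j, sgnr (entry j (dataY pos th W w)) / Num.sqrt 2 = entry j x.
Proof.
have entryX j : entry j (dataX pos th W w) =
    sgnr (entry j (dataY pos th W w)) / Num.sqrt 2.
  by case: j => [[m t] b]; rewrite /entry /dataX !mxE; case: b.
split=> [<- j|Xx]; first by rewrite entryX.
by apply: entry_inj => j; rewrite entryX.
Qed.

Lemma measurable_dataX_eq pos th d (T : measurableType d)
    (W : L -> T -> R) (x : 'M[R[i]]_(M, N)) :
  (forall l, measurable_fun setT (W l)) ->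
  measurable [set w | dataX pos th W w = x].
Proof.
move=> mW.
have -> : [set w | dataX pos th W w = x] = \bigcap_(j in [set: J])
    ((fun w => entry j (dataY pos th W w)) @^-1`
       [set y | sgnr y / Num.sqrt 2 = entry j x]).
  apply/seteqP; split=> w /=; first by move=> /dataX_eqP e j _; exact: e.
  by move=> e; apply/dataX_eqP => j; exact: e.
apply: fin_bigcap_measurable; first exact: finite_finset.
move=> j _; rewrite -[X in measurable X]setTI.
by apply: measurable_entry_dataY => //; exact: measurable_sgnr_level.
Qed.

Lemma tnth_realvec (Y : 'M[R[i]]_(M, N)) (j : J) :
  tnth (realvec Y) (enum_rank j) = entry j Y.
Proof. by rewrite tnth_fgraph enum_rankK ffunE. Qed.

(** Quantization acts coordinatewise and measurably, so each event [X = x] is the event that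
    [realvec] of the data lies in one measurable set [B], the same for both models. *)
Lemma same_law_Y_X pos (th1 th2 : 'I_K -> R)
    d1 (T1 : measurableType d1) (P1 : probability T1 R) (W1 : L -> T1 -> R)
    d2 (T2 : measurableType d2) (P2 : probability T2 R) (W2 : L -> T2 -> R) :
  same_law_Y pos th1 th2 P1 W1 P2 W2 -> same_law_X pos th1 th2 P1 W1 P2 W2.
Proof.
move=> lawY x.
pose B : set (#|{: J}|.-tuple R) := \bigcap_(j in [set: J])
  ((fun v => tnth v (enum_rank j)) @^-1`
     [set y | sgnr y / Num.sqrt 2 = entry j x]).
have mB : measurable B.
  apply: fin_bigcap_measurable; first exact: finite_finset.
  move=> j _; rewrite -[X in measurable X]setTI.
  by apply: measurable_tnth => //; exact: measurable_sgnr_level.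
have XB th T (W : L -> T -> R) : [set w | dataX pos th W w = x] =
    (fun w => realvec (dataY pos th W w)) @^-1` B.
  apply/seteqP; split=> w /=.
    by move=> /dataX_eqP e j _ /=; rewrite tnth_realvec; exact: e.
  by move=> e; apply/dataX_eqP => j; rewrite -tnth_realvec; exact: e.
by rewrite !XB lawY.
Qed.

(** The finitely many possible values of [dataX], indexed by sign patterns in which [true] marks a
    nonnegative coordinate. *)
Definition sign_mx (s : {ffun J -> bool}) : 'M[R[i]]_(M, N) :=
  \matrix_(m, t) Complex ((-1) ^+ (~~ s (m, t, false)) / Num.sqrt 2)
                         ((-1) ^+ (~~ s (m, t, true)) / Num.sqrt 2).

Lemma dataX_sign_mxP pos th T (W : L -> T -> R) w s :
  dataX pos th W w = sign_mx s <->
  forall j, (0 <= entry j (dataY pos th W w)) = s j.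
Proof.
have entryS j : entry j (sign_mx s) = (-1) ^+ (~~ s j) / Num.sqrt 2.
  by case: j => [[m t] []]; rewrite /entry !mxE.
have q0 : (Num.sqrt 2)^-1 != 0 :> R by rewrite invr_eq0 gt_eqF// sqrtr_gt0.
have sgnrE (y : R) b :
    sgnr y / Num.sqrt 2 = (-1) ^+ (~~ b) / Num.sqrt 2 <-> (0 <= y) = b.
  rewrite /sgnr; split=> [/(mulIf q0)|<-]; last by case: (0 <= y).
  by case: (0 <= y); case: b => //= e; exfalso; lra.
split=> [/dataX_eqP e j|e].
  by apply/sgnrE; rewrite e entryS.
by apply/dataX_eqP => j; rewrite entryS; apply/sgnrE.
Qed.

(** The event is the finite disjoint union of the events [dataX = sign_mx s] over the patterns [s]
    that are true at [j] and [k]. *)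
Lemma same_law_X_orthant pos (th1 th2 : 'I_K -> R)
    d1 (T1 : measurableType d1) (P1 : probability T1 R) (W1 : L -> T1 -> R)
    d2 (T2 : measurableType d2) (P2 : probability T2 R) (W2 : L -> T2 -> R)
    (j k : J) :
  (forall l, measurable_fun setT (W1 l)) ->
  (forall l, measurable_fun setT (W2 l)) ->
  same_law_X pos th1 th2 P1 W1 P2 W2 ->
  P1 [set w | 0 <= entry j (dataY pos th1 W1 w) /\ 0 <= entry k (dataY pos th1 W1 w)] =
  P2 [set w | 0 <= entry j (dataY pos th2 W2 w) /\ 0 <= entry k (dataY pos th2 W2 w)].
Proof.
move=> mW1 mW2 lawX.
pose S : set {ffun J -> bool} :=
  [set s : {ffun J -> bool} | s j /\ s k].
have orthantE th d (T : measurableType d) (P : probability T R) (W : L -> T -> R) :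
    (forall l, measurable_fun setT (W l)) ->
    P [set w | 0 <= entry j (dataY pos th W w) /\ 0 <= entry k (dataY pos th W w)] =
    (\sum_(s \in S) P [set w | dataX pos th W w = sign_mx s])%E.
  move=> mW; rewrite -measure_fin_bigcup; first last.
  - by move=> s _; exact: measurable_dataX_eq.
  - move=> s1 s2 _ _ [w [/dataX_sign_mxP e1 /dataX_sign_mxP e2]].
    by apply/ffunP => l; rewrite -e1 -e2.
  - exact: finite_finset.
  congr (P _); apply/seteqP; split=> w /=.
    move=> [Yj Yk]; exists [ffun l => 0 <= entry l (dataY pos th W w)].
      by rewrite /S /= !ffunE.
    by apply/dataX_sign_mxP => l; rewrite ffunE.
  by move=> [s [sj sk] /dataX_sign_mxP e]; rewrite !e.
rewrite !orthantE//; apply: eq_fsbigr => s _; exact: lawX.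
Qed.

End laws.

(** * From equal one-bit laws to equal Gram matrices and equal unquantized laws *)

Section equal_one_bit_laws.
Context {R : realType} (K M N : nat).
Implicit Types (pos : 'I_M -> int) (th p : 'I_K -> R).
Local Notation J := ('I_M * 'I_N * bool)%type.
Local Notation L := (latent K M N).

(** Signs do not see the scale, so Gram entries are compared after division by the common squared
    norm. On the diagonal both ratios are 1; off it they are read off from orthant probabilities. *)
Lemma same_law_X_gram pos th1 th2 p1 p2 (n1 n2 : R)
    d1 (T1 : measurableType d1) (P1 : probability T1 R) (W1 : L -> T1 -> R)
    d2 (T2 : measurableType d2) (P2 : probability T2 R) (W2 : L -> T2 -> R)
    (j k : J) :
  (forall k, 0 < p1 k) -> 0 < n1 -> (forall k, 0 < p2 k) -> 0 < n2 ->
  realization p1 n1 P1 W1 -> realization p2 n2 P2 W2 ->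
  same_law_X pos th1 th2 P1 W1 P2 W2 ->
  dot (data_row pos th1 p1 n1 j) (data_row pos th1 p1 n1 k) / power p1 n1 =
  dot (data_row pos th2 p2 n2 j) (data_row pos th2 p2 n2 k) / power p2 n2.
Proof.
move=> p10 n10 p20 n20 real1 real2 lawX.
have r10 := power_gt0 p10 n10; have r20 := power_gt0 p20 n20.
have [->|jk] := eqVneq j k.
  by rewrite !dot_data_row_diag// !divff ?gt_eqF.
have iid1 := realization_iid p10 n10 real1.
have iid2 := realization_iid p20 n20 real2.
have entryE th p (n : R) T (W : L -> T -> R) w l :
    (forall k, 0 < p k) -> 0 < n ->
    entry l (dataY pos th W w) =
    dot (data_row pos th p n l) (fun i => (stddev p n i)^-1 * W i w).
  move=> p0 n0; rewrite entry_dataY -dot_coef_stddev; congr dot.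
  by apply/funext => i; rewrite mulVKf// gt_eqF// stddev_gt0.
(* The noise variables of the two data coordinates supply the two distinct latent indices that the
   planar reduction needs. *)
have jk' : (inr j : L) != inr k by [].
apply: (orthant_prob_inj iid1 iid2 jk' r10 r20).
- exact: dot_data_row_diag.
- exact: dot_data_row_diag.
- exact: dot_data_row_offdiag.
- exact: dot_data_row_diag.
- exact: dot_data_row_diag.
- exact: dot_data_row_offdiag.
have [[mW1 _] _ _] := real1; have [[mW2 _] _ _] := real2.
have := same_law_X_orthant j k mW1 mW2 lawX.
under eq_set do rewrite !(entryE _ _ _ _ _ _ _ p10 n10).
under [X in _ = P2 X]eq_set do rewrite !(entryE _ _ _ _ _ _ _ p20 n20).
by [].
Qed.

(** The standardized latent variables are transported by the map [g] and then rescaled to the second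
    parameters; the two data matrices then coincide pointwise, not merely in law. *)
Lemma equal_gram_same_law_Y pos th1 th2 p1 p2 (n1 n2 : R)
    d (T : measurableType d) (P : probability T R) (W1 : L -> T -> R) :
  (forall k, 0 < p1 k) -> 0 < n1 -> (forall k, 0 < p2 k) -> 0 < n2 ->
  (forall j k : J, dot (data_row pos th1 p1 n1 j) (data_row pos th1 p1 n1 k) =
               dot (data_row pos th2 p2 n2 j) (data_row pos th2 p2 n2 k)) ->
  realization p1 n1 P W1 ->
  exists2 W2 : L -> T -> R, realization p2 n2 P W2 &
    same_law_Y pos th1 th2 P W1 P W2.
Proof.
move=> p10 n10 p20 n20 gram real1.
have iid1 := realization_iid p10 n10 real1.
have [g gP gA] := equal_gram_preserving P gram.
pose Z2 l w := g (fun i => (stddev p1 n1 i)^-1 * W1 i w) l.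
exists (fun l w => stddev p2 n2 l * Z2 l w).
  by apply: iid_realization => //; exact: (gP _ iid1).
suff YE w : dataY pos th1 W1 w = dataY pos th2 (fun l w => stddev p2 n2 l * Z2 l w) w.
  move=> B mB; congr (P _); apply/seteqP.
  by split=> w; rewrite /preimage /= YE.
apply: entry_inj => j; rewrite !entry_dataY dot_coef_stddev gA -dot_coef_stddev.
congr dot; apply/funext => i.
by rewrite mulVKf// gt_eqF// stddev_gt0.
Qed.

End equal_one_bit_laws.

Theorem theorem1 (R : realType) (K M N : nat) (pos : 'I_M -> int)
    (pos_inj : injective pos) (th0 : 'I_K -> R)
    (th0_inj : injective th0) (th0_range : doa_range th0) :
  identifiable_X N pos th0 <-> identifiable_Y N pos th0.
Proof.
split=> [idX|idY].
  (* Any witness against identifiability from [Y] is, unchanged, a witness against identifiability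
     from [X]. *)
  move=> [thb [p [pb [s2 [s2b [hth [hp]]]]]]].
  move=> [d1 [T1 [P1 [W1 [d2 [T2 [P2 [W2 [real1 real2 lawY]]]]]]]]].
  apply: idX; exists thb, p, pb, s2, s2b; split=> //; split=> //.
  exists d1, T1, P1, W1, d2, T2, P2, W2; split=> //.
  exact: same_law_Y_X.
move=> [thb [p [pb [s2 [s2b [hth [[p0 pb0 s20 s2b0]]]]]]]].
move=> [d1 [T1 [P1 [W1 [d2 [T2 [P2 [W2 [real1 real2 lawX]]]]]]]]].
have r10 := power_gt0 p0 s20; have r20 := power_gt0 pb0 s2b0.
(* Multiplying the alternative powers and noise variance by [c] equalizes the squared norms, so that
   the normalized Gram identities become plain ones. *)
pose c := power p s2 / power pb s2b.
have c0 : 0 < c by rewrite divr_gt0.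
have cpb0 k : 0 < c * pb k by rewrite mulr_gt0.
have cs2b0 : 0 < c * s2b by rewrite mulr_gt0.
have gram (j k : 'I_M * 'I_N * bool) :
    dot (data_row pos th0 p s2 j) (data_row pos th0 p s2 k) =
    dot (data_row pos thb (fun k => c * pb k) (c * s2b) j)
        (data_row pos thb (fun k => c * pb k) (c * s2b) k).
  transitivity (c * dot (data_row pos thb pb s2b j) (data_row pos thb pb s2b k)).
    have e := same_law_X_gram j k p0 s20 pb0 s2b0 real1 real2 lawX.
    by rewrite /c mulrAC -mulrA -e mulrC divfK// gt_eqF.
  have cE : c = Num.sqrt c ^+ 2 by rewrite sqr_sqrtr// ltW.
  rewrite /dot mulr_sumr; apply: eq_bigr => l _.
  by rewrite /data_row !stddev_scale ?ltW// [in LHS]cE; ring.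
have [W2' real2' lawY] := equal_gram_same_law_Y p0 s20 cpb0 cs2b0 gram real1.
(* The alternative angles [thb] are kept and only their powers and noise variance are rescaled; both
   realizations live on [T1]. *)
apply: idY; exists thb, p, (fun k => c * pb k), s2, (c * s2b).
split=> //; split=> //.
by exists d1, T1, P1, W1, d1, T1, P1, W2'; split.
Qed.
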